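(* The semigroup $S$ given by the semigroup presentation $$S = \langle a,b,c,e,x \mid axb = acx,\ ac = ca,\ xca = xe,\ ea = ae,\ aex = ax,\ xexb = bxex \rangle$$ is $\mathcal{J}$-trivial.
   Context: For a semigroup $S$, $S^1$ denotes $S$ if $S$ has an identity and $S$ with an external identity adjoined otherwise. Elements $x,y\in S$ are $\mathcal{J}$-related if $S^1xS^1 = S^1yS^1$. $S$ is $\mathcal{J}$-trivial if any two $\mathcal{J}$-related elements are equal. The presentation is a semigroup presentation: $S$ is the quotient of the free semigroup (nonempty words) on the generators by the congruence generated by the relations; the generator $e$ is not assumed to be idempotent or an identity. *)

(* Defs.v *)
From HB Require Import structures.
From mathcomp Require Import all_boot generic_quotient.
From mathcomp Require Import boolp classical_sets.

Set Implicit Arguments.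
Unset Strict Implicit.
Unset Printing Implicit Defensive.

Local Open Scope classical_set_scope.
Local Open Scope group_scope.

Definition is_identity (S : semigroupType) (u : S) : Prop :=
  left_id u (@mul S) /\ right_id u (@mul S).

Definition has_identity (S : semigroupType) : Prop :=
  exists u : S, is_identity u.

(* S itself, as a monoid, given that it has an identity. *)
Definition own1 (S : semigroupType) (h : has_identity S) : Type := S.

Section OwnIdentity.
Variables (S : semigroupType) (h : has_identity S).

HB.instance Definition _ := Semigroup.copy (own1 h) S.

Let u : own1 h := projT1 (cid h).

Let own1_mul1g : left_id u mul.
Proof. exact: (projT2 (cid h)).1. Qed.

Let own1_mulg1 : right_id u mul.
Proof. exact: (projT2 (cid h)).2. Qed.

HB.instance Definition _ :=
  Semigroup_isMonoid.Build (own1 h) own1_mul1g own1_mulg1.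
End OwnIdentity.

(* S with an external identity None adjoined. *)
Definition adjoin1 (S : semigroupType) : Type := option S.

Section AdjoinIdentity.
Variable S : semigroupType.

HB.instance Definition _ := Choice.copy (adjoin1 S) (option S).

Let adjoin1_mul (p q : adjoin1 S) : adjoin1 S :=
  match p, q with
  | Some x, Some y => Some (x * y)
  | None, _ => q
  | _, None => p
  end.

Let adjoin1_mulA : associative adjoin1_mul.
Proof. by move=> [x|] [y|] [z|] //=; rewrite mulgA. Qed.

Let adjoin1_mul1g : left_id None adjoin1_mul.
Proof. by case. Qed.

Let adjoin1_mulg1 : right_id None adjoin1_mul.
Proof. by case. Qed.

HB.instance Definition _ :=
  isMonoid.Build (adjoin1 S) adjoin1_mulA adjoin1_mul1g adjoin1_mulg1.
End AdjoinIdentity.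

(* S^1; the classical case analysis chooses between the two definitions above. *)
Definition semigroup1 (S : semigroupType) : monoidType :=
  match pselect (has_identity S) with
  | left h => own1 h
  | right _ => adjoin1 S
  end.

Definition to_semigroup1 (S : semigroupType) (x : S) : semigroup1 S :=
  match pselect (has_identity S) as d
    return match d with left h => own1 h | right _ => adjoin1 S end : monoidType
  with
  | left _ => x
  | right _ => Some x
  end.

(* S^1 x S^1, as a subset of S^1 *)
Definition principal_ideal (S : semigroupType) (x : S) : set (semigroup1 S) :=
  [set z | exists p q : semigroup1 S, z = p * to_semigroup1 x * q].

Definition J_related (S : semigroupType) (x y : S) : Prop :=
  principal_ideal x = principal_ideal y.

Definition J_trivial (S : semigroupType) : Prop :=
  forall x y : S, J_related x y -> x = y.

Record free_semigroup (A : choiceType) : Type :=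
  FreeSemigroup { word :> seq A; _ : word != [::] }.

Section FreeSemigroup.
Variable A : choiceType.

HB.instance Definition _ := [isSub for @word A].
HB.instance Definition _ := [Choice of free_semigroup A by <:].

Let word_cat_neq0 (u v : free_semigroup A) : word u ++ word v != [::].
Proof. by case: u => [[]]. Qed.

Let free_mul (u v : free_semigroup A) : free_semigroup A :=
  FreeSemigroup (word_cat_neq0 u v).

Let free_mulA : associative free_mul.
Proof. by move=> u v w; apply: val_inj; rewrite /= catA. Qed.

HB.instance Definition _ := isSemigroup.Build (free_semigroup A) free_mulA.

Definition letter (g : A) : free_semigroup A := @FreeSemigroup A [:: g] isT.
End FreeSemigroup.

Inductive generated_congruence (F : semigroupType) (R : seq (F * F)) :
    F -> F -> Prop :=
  | GC_base u v : (u, v) \in R -> generated_congruence R u v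
  | GC_refl u : generated_congruence R u u
  | GC_sym u v : generated_congruence R u v -> generated_congruence R v u
  | GC_trans u v w : generated_congruence R u v ->
      generated_congruence R v w -> generated_congruence R u w
  | GC_mul u u' v v' : generated_congruence R u u' ->
      generated_congruence R v v' -> generated_congruence R (u * v) (u' * v').

Section Presentation.
Variables (A : choiceType) (R : seq (free_semigroup A * free_semigroup A)).

Let congb : rel (free_semigroup A) := fun u v => `[< generated_congruence R u v >].

Let congb_refl : reflexive congb.
Proof. by move=> u; apply/asboolP; apply: GC_refl. Qed.

Let congb_sym : symmetric congb.
Proof. by move=> u v; apply/asboolP/asboolP => /GC_sym. Qed.

Let congb_trans : transitive congb.
Proof.
by move=> v u w /asboolP uv /asboolP vw; apply/asboolP; apply: GC_trans uv vw.
Qed.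

Definition congruence_rel : equiv_rel (free_semigroup A) :=
  EquivRel congb congb_refl congb_sym congb_trans.

Local Open Scope quotient_scope.

Definition presented : Type := {eq_quot congruence_rel}.

HB.instance Definition _ := Choice.copy presented {eq_quot congruence_rel}.
HB.instance Definition _ :=
  EqQuotient.copy presented {eq_quot congruence_rel}.

Let presented_mul (s t : presented) : presented :=
  \pi_presented (repr s * repr t).

Let presented_mulA : associative presented_mul.
Proof.
have repr_pi (u : free_semigroup A) :
    generated_congruence R (repr (\pi_presented u)) u.
  by apply/asboolP; have /eqmodP := reprK (\pi_presented u).
move=> s t w; rewrite /presented_mul; apply/eqmodP/asboolP.
apply: (@GC_trans _ _ _ (repr s * (repr t * repr w))).
  exact: GC_mul (GC_refl _ _) (repr_pi _).
rewrite mulgA; apply: GC_sym.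
exact: GC_mul (repr_pi _) (GC_refl _ _).
Qed.

HB.instance Definition _ := isSemigroup.Build presented presented_mulA.
End Presentation.

Inductive generator := gen_a | gen_b | gen_c | gen_e | gen_x.

Definition nat_of_generator (g : generator) : nat :=
  match g with
  | gen_a => 0 | gen_b => 1 | gen_c => 2 | gen_e => 3 | gen_x => 4
  end.

Definition generator_of_nat (n : nat) : generator :=
  nth gen_a [:: gen_a; gen_b; gen_c; gen_e; gen_x] n.

Lemma nat_of_generatorK : cancel nat_of_generator generator_of_nat.
Proof. by case. Qed.

HB.instance Definition _ := Choice.copy generator (can_type nat_of_generatorK).

(* Main.v *)
(* Write J-equivalent u and v as u = p v q and v = r u s in S^1, so that
   u = (p r) u (s q). The relations preserve the number of x, the number of a
   before the first x, the number of a and e after the last x, and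
   #b + #c - #a; hence p r is a power of e and s q is empty. It remains to see
   that e^n u = u with n > 0 forces e u = u. The number of e before the first
   b or x is preserved by every relation except aex = ax applied to a word
   p aex q with p over {a, c, e}, and such words are fixed by e because a
   commutes with p, which lets a absorb the e's and turn the c's into b's
   beyond the x. *)
Require Import Defs.
From mathcomp Require Import all_boot.
From mathcomp Require Import generic_quotient boolp zify.
From Stdlib Require Import Setoid Morphisms.

Set Implicit Arguments.
Unset Strict Implicit.
Unset Printing Implicit Defensive.

Local Open Scope group_scope.

(** * The presentation congruence as rewriting on words *)

Section WordCongruence.
Variables (A : choiceType) (R : seq (free_semigroup A * free_semigroup A)).

(** Rewriting in a context, on words that may be empty: an invariant then has to be checked only on
    one relation between arbitrary [p] and [q]. *)
Inductive word_cong : seq A -> seq A -> Prop :=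
  | WC_step p q u v : (u, v) \in R ->
      word_cong (p ++ word u ++ q) (p ++ word v ++ q)
  | WC_refl u : word_cong u u
  | WC_sym u v : word_cong u v -> word_cong v u
  | WC_trans u v w : word_cong u v -> word_cong v w -> word_cong u w.

#[global] Instance word_cong_equiv : Equivalence word_cong.
Proof.
split; [exact: WC_refl | exact: WC_sym | exact: WC_trans].
Qed.

Lemma word_cong_context p q u v :
  word_cong u v -> word_cong (p ++ u ++ q) (p ++ v ++ q).
Proof.
elim=> {u v} [p' q' u v uvR | u | u v _ | u v w _ + _].
- by have := WC_step (p ++ p') (q' ++ q) uvR; rewrite -!catA.
- exact: WC_refl.
- exact: WC_sym.
- exact: WC_trans.
Qed.

#[global] Instance word_cong_cat :
  Proper (word_cong ==> word_cong ==> word_cong) (@cat A).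
Proof.
move=> u u' uu' v v' vv'; apply: (@WC_trans _ (u' ++ v)).
  exact: (@word_cong_context [::] v _ _ uu').
by have := word_cong_context u' [::] vv'; rewrite !cats0.
Qed.

#[global] Instance word_cong_cons (g : A) :
  Proper (word_cong ==> word_cong) (cons g).
Proof.
by move=> u v uv; have := word_cong_context [:: g] [::] uv; rewrite !cats0.
Qed.

Lemma generated_congruence_word u v :
  generated_congruence R u v -> word_cong (word u) (word v).
Proof.
elim=> {u v} [u v uvR | u | u v _ | u v w _ + _ | u u' v v' _ uu' _ vv'].
- by have := WC_step [::] [::] uvR; rewrite !cats0.
- exact: WC_refl.
- exact: WC_sym.
- exact: WC_trans.
- exact: word_cong_cat.
Qed.

(** The free semigroup has no empty word, so an empty context cannot be a factor; each of the four
    emptiness patterns of [p] and [q] gets its own product. *)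
Lemma generated_congruence_context p q u v s t :
    generated_congruence R u v ->
    word s = p ++ word u ++ q -> word t = p ++ word v ++ q ->
  generated_congruence R s t.
Proof.
case: p q => [|g p] [|h q] uv.
- by rewrite !cats0 /= => /val_inj -> /val_inj ->.
- move=> su tv; pose w := @FreeSemigroup A (h :: q) isT.
  have -> : s = u * w by apply: val_inj.
  have -> : t = v * w by apply: val_inj.
  exact: GC_mul uv (GC_refl _ _).
- rewrite !cats0 => su tv; pose w := @FreeSemigroup A (g :: p) isT.
  have -> : s = w * u by apply: val_inj.
  have -> : t = w * v by apply: val_inj.
  exact: GC_mul (GC_refl _ _) uv.
- move=> su tv; pose w := @FreeSemigroup A (g :: p) isT.
  pose w' := @FreeSemigroup A (h :: q) isT.
  have -> : s = w * (u * w') by apply: val_inj.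
  have -> : t = w * (v * w') by apply: val_inj.
  exact: GC_mul (GC_refl _ _) (GC_mul uv (GC_refl _ _)).
Qed.

(** The induction also carries that emptiness is preserved, so that the middle word in a
    transitivity step is again an element of the free semigroup. *)
Lemma word_cong_generated_congruence u v :
  word_cong (word u) (word v) -> generated_congruence R u v.
Proof.
suff gen (s t : seq A) : word_cong s t ->
    (s == [::]) = (t == [::]) /\
    forall u v, word u = s -> word v = t -> generated_congruence R u v.
  by move=> /gen[_]; apply.
elim=> {u v s t} [p q u v uvR | w | s t _ [-> st] | s t w _ [-> st] _ [tw0 tw]].
- split; last by move=> s t; apply/generated_congruence_context/GC_base.
  by case: p (valP u) (valP v) => //=; case: (word u); case: (word v).
- by split=> // u v uw vw; have /val_inj -> := etrans uw (esym vw); apply: GC_refl.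
- by split=> // u v ut vs; apply/GC_sym/st.
- split=> // u v us vw.
  have t0 : t != [::] by rewrite tw0 -vw; case: (v).
  pose m := FreeSemigroup t0.
  exact: (GC_trans (st u m us erefl) (tw m v erefl vw)).
Qed.

Lemma word_repr_mul (s t : presented R) :
  word_cong (word (repr (s * t))) (word (repr s) ++ word (repr t)).
Proof.
apply: (@generated_congruence_word _ (repr s * repr t)).
by apply/asboolP; have /eqmodP := reprK (s * t).
Qed.

Lemma word_repr_inj (s t : presented R) :
  word_cong (word (repr s)) (word (repr t)) -> s = t.
Proof.
move=> /word_cong_generated_congruence st.
by rewrite -[s]reprK -[t]reprK; apply/eqmodP/asboolP.
Qed.

End WordCongruence.

(** * J-related elements in terms of words *)

Lemma J_related_adjoin1 (S : semigroupType) (s t : S) :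
  J_related s t ->
  exists p q : adjoin1 S, Some s = p * (Some t : adjoin1 S) * q :> adjoin1 S.
Proof.
rewrite /J_related => st.
have : principal_ideal s (to_semigroup1 s) by exists 1, 1; rewrite mul1g mulg1.
rewrite {}st /principal_ideal /= /to_semigroup1 /semigroup1.
case: pselect => [h|h] [p [q def_s]]; last by exists p, q.
(* Here [S] has an identity, so the multipliers lie in [S] itself. *)
by exists (Some p), (Some q); rewrite def_s.
Qed.

Lemma J_related_word (A : choiceType)
    (R : seq (free_semigroup A * free_semigroup A)) (s t : presented R) :
  J_related s t ->
  exists p q, word_cong R (word (repr s)) (p ++ word (repr t) ++ q).
Proof.
move=> /J_related_adjoin1[p [q def_s]].
(* The adjoined identity becomes the empty word. *)
exists (if p is Some p' then word (repr p') else [::]).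
exists (if q is Some q' then word (repr q') else [::]).
case: p q def_s => [p|] [q|] [->]; rewrite ?cats0 ?catA ?cat0s.
- etransitivity; first exact: word_repr_mul.
  apply: word_cong_cat; [exact: word_repr_mul | exact: WC_refl].
- exact: word_repr_mul.
- exact: word_repr_mul.
- exact: WC_refl.
Qed.

(** * The six relations on words *)

Section Lemma5.

Let a := letter gen_a.
Let b := letter gen_b.
Let c := letter gen_c.
Let e := letter gen_e.
Let x := letter gen_x.

Definition lemma5_relations :=
  [:: (a * x * b, a * c * x);
      (a * c, c * a);
      (x * c * a, x * e);
      (e * a, a * e);
      (a * e * x, a * x);
      (x * e * x * b, b * x * e * x)].

#[local] Hint Resolve WC_refl : core.

Local Notation "u ≈ v" :=
  (word_cong lemma5_relations (u : seq generator) (v : seq generator))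
  (at level 70).

(** Literal words, so that case analysis on a relation lets the counting functions below compute. *)
Variant lemma5_relation : seq generator -> seq generator -> Prop :=
  | Rel_axb : lemma5_relation [:: gen_a; gen_x; gen_b] [:: gen_a; gen_c; gen_x]
  | Rel_ac : lemma5_relation [:: gen_a; gen_c] [:: gen_c; gen_a]
  | Rel_xca : lemma5_relation [:: gen_x; gen_c; gen_a] [:: gen_x; gen_e]
  | Rel_ea : lemma5_relation [:: gen_e; gen_a] [:: gen_a; gen_e]
  | Rel_aex : lemma5_relation [:: gen_a; gen_e; gen_x] [:: gen_a; gen_x]
  | Rel_xexb : lemma5_relation
      [:: gen_x; gen_e; gen_x; gen_b] [:: gen_b; gen_x; gen_e; gen_x].

Lemma lemma5_relationsP u v :
  (u, v) \in lemma5_relations -> lemma5_relation (word u) (word v).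
Proof. by rewrite !inE; do 5?[case/orP]; move=> /eqP[-> ->]; constructor. Qed.

Lemma word_cong_axb q :
  [:: gen_a, gen_x, gen_b & q] ≈ [:: gen_a, gen_c, gen_x & q].
Proof. exact: (@WC_step _ _ [::] q (a * x * b) (a * c * x)). Qed.

Lemma word_cong_ac q : [:: gen_a, gen_c & q] ≈ [:: gen_c, gen_a & q].
Proof. exact: (@WC_step _ _ [::] q (a * c) (c * a)). Qed.

Lemma word_cong_ea q : [:: gen_e, gen_a & q] ≈ [:: gen_a, gen_e & q].
Proof. exact: (@WC_step _ _ [::] q (e * a) (a * e)). Qed.

Lemma word_cong_aex q :
  [:: gen_a, gen_e, gen_x & q] ≈ [:: gen_a, gen_x & q].
Proof. exact: (@WC_step _ _ [::] q (a * e * x) (a * x)). Qed.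

(** * Absorption of e *)

Definition commutes_with_a (g : generator) : bool :=
  match g with gen_b | gen_x => false | _ => true end.

Lemma word_cong_a_comm p q :
  all commutes_with_a p -> gen_a :: p ++ q ≈ p ++ gen_a :: q.
Proof.
elim: p => [//|g p IHp /= /andP[g_ok p_ok]].
apply: (@WC_trans _ _ _ [:: g, gen_a & p ++ q]); last by rewrite IHp.
case: g g_ok => // _.
- exact: word_cong_ac.
- by rewrite word_cong_ea.
Qed.

(** Induction on the letter of [p] next to the x, with [q] general. The leading a travels to that
    letter: an a is moved to the front, a c leaves as a b behind the x by axb = acx, and an e
    vanishes by aex = ax. *)
Lemma word_cong_e_absorbed p q : all commutes_with_a p ->
  [:: gen_e, gen_a & p ++ gen_x :: q] ≈ gen_a :: p ++ gen_x :: q.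
Proof.
elim/last_ind: p q => [|p g IHp] q.
  by move=> _; rewrite /= word_cong_ea word_cong_aex.
rewrite all_rcons cat_rcons => /andP[g_ok p_ok].
have comm w := @word_cong_a_comm p w p_ok.
case: g g_ok => // _.
- by rewrite -comm word_cong_ea IHp.
- have drop_c : gen_a :: p ++ [:: gen_c, gen_x & q] ≈
      gen_a :: p ++ [:: gen_x, gen_b & q].
    by rewrite !comm word_cong_axb.
  by rewrite drop_c IHp.
- have drop_e : gen_a :: p ++ [:: gen_e, gen_x & q] ≈
      gen_a :: p ++ gen_x :: q.
    by rewrite !comm word_cong_aex.
  by rewrite drop_e IHp.
Qed.

(** * Counting invariants *)

Fixpoint count_a_before_x (w : seq generator) : nat :=
  match w with
  | gen_a :: w' => (count_a_before_x w').+1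
  | gen_x :: _ | [::] => 0
  | _ :: w' => count_a_before_x w'
  end.

(* the number of a and e after the last x, or [n] more in a word without x *)
Definition count_ae_after_x : nat -> seq generator -> nat :=
  foldl (fun n g => match g with gen_x => 0 | gen_a | gen_e => n.+1 | _ => n end).

(** It stops at exactly the letters rejected by [commutes_with_a], so rewriting beyond such a letter
    leaves it unchanged. *)
Fixpoint count_e_before_bx (w : seq generator) : nat :=
  match w with
  | gen_e :: w' => (count_e_before_bx w').+1
  | gen_b :: _ | gen_x :: _ | [::] => 0
  | _ :: w' => count_e_before_bx w'
  end.

Lemma count_x_cong u v : u ≈ v -> count_mem gen_x u = count_mem gen_x v.
Proof.
elim=> {u v} [p q u v uvR|//|//|u v w _ -> //].
by case/lemma5_relationsP: uvR; rewrite !count_cat.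
Qed.

(** This is invariance of #b + #c - #a, with the subtracted terms moved across to stay in the
    natural numbers. *)
Lemma weight_cong u v : u ≈ v ->
  (count_mem gen_b u + count_mem gen_c u + count_mem gen_a v =
   count_mem gen_b v + count_mem gen_c v + count_mem gen_a u)%N.
Proof.
elim=> {u v} [p q u v uvR|//|//|u v w _ uv _ vw]; last by lia.
by case/lemma5_relationsP: uvR; rewrite !count_cat /=; lia.
Qed.

Lemma count_a_before_x_cong u v :
  u ≈ v -> count_a_before_x u = count_a_before_x v.
Proof.
elim=> {u v} [p q u v uvR|//|//|u v w _ -> //].
by case/lemma5_relationsP: uvR; elim: p => [|[] p IHp] //=; rewrite IHp.
Qed.

Lemma count_ae_after_x_cong n u v :
  u ≈ v -> count_ae_after_x n u = count_ae_after_x n v.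
Proof.
elim=> {u v} [p q u v uvR|//|//|u v w _ -> //].
by case/lemma5_relationsP: uvR; rewrite /count_ae_after_x !foldl_cat.
Qed.

Lemma count_a_before_x_cat p w : count_mem gen_x p = 0%N ->
  count_a_before_x (p ++ w) = (count_mem gen_a p + count_a_before_x w)%N.
Proof. by elim: p => //= -[] p IHp //= /IHp ->. Qed.

Lemma count_a_before_x_prefix u q :
  count_a_before_x u <= count_a_before_x (u ++ q).
Proof. by elim: u => [//|[] u IHu] /=. Qed.

Lemma count_ae_after_x_mono m n w :
  m <= n -> count_ae_after_x m w <= count_ae_after_x n w.
Proof. by elim: w m n => //= g w IHw m n mn; apply: IHw; case: g. Qed.

Lemma count_ae_after_x_free n q : count_mem gen_x q = 0%N ->
  count_ae_after_x n q = (n + count_mem gen_a q + count_mem gen_e q)%N.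
Proof.
elim: q n => [|g q IHq] n /=; first by lia.
by case: g => //= xq; rewrite IHq //=; lia.
Qed.

(** * Multipliers that fix a word *)

Lemma size_count_letters (w : seq generator) :
  size w = (count_mem gen_a w + count_mem gen_b w + count_mem gen_c w +
            count_mem gen_e w + count_mem gen_x w)%N.
Proof. by elim: w => [|[] w IHw] //=; rewrite IHw /=; lia. Qed.

(** The x-count makes [p] and [q] free of x. Any a in [p] would then add to the a's before the first
    x, and any a or e in [q] to those after the last x. With no a left, the weight excludes b and
    c. *)
Lemma stabilizer_letters p q u : u ≈ p ++ u ++ q ->
  p = nseq (size p) gen_e /\ q = [::].
Proof.
move=> upq.
have := count_x_cong upq; rewrite !count_cat => x0.
have xp : count_mem gen_x p = 0%N by lia.
have xq : count_mem gen_x q = 0%N by lia.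
have := count_a_before_x_cong upq; rewrite count_a_before_x_cat // => ap.
have := count_ae_after_x_cong 0 upq.
rewrite /count_ae_after_x !foldl_cat -!/(count_ae_after_x _ _).
rewrite (count_ae_after_x_free _ xq) => aeq.
have weight := weight_cong upq; rewrite !count_cat in weight.
(* Reading [p] first only raises the start value of the count on [u]. *)
have mono := count_ae_after_x_mono u (leq0n (count_ae_after_x 0 p)).
have prefix := count_a_before_x_prefix u q.
have sp := size_count_letters p; have sq := size_count_letters q.
have pe : count_mem gen_e p = size p by lia.
split; last by apply: size0nil; lia.
by apply/all_pred1P; rewrite all_count; apply/eqP.
Qed.

(** Being fixed by e is itself invariant under the congruence, so the alternative survives symmetry
    and transitivity; only single rewriting steps need work. *)
Lemma e_fixed_or_count_e u v : u ≈ v ->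
  gen_e :: u ≈ u \/ count_e_before_bx u = count_e_before_bx v.
Proof.
elim=> {u v} [p q u v uvR|u|u v uv [eu|->]|u v w uv [eu _ _|-> vw [ev|->]]];
  try by [right | left].
- have := WC_step p q uvR.
  case/lemma5_relationsP: uvR => pq.
  1-4,6: by right; elim: p {pq} => [|[] p IHp] //=; rewrite IHp.
  (* The remaining relation is aex = ax: either the absorption lemma applies, or the count already
     stops inside [p]. *)
  have [pa|pn] := boolP (all commutes_with_a p); [left | right].
    rewrite pq /= -(word_cong_a_comm _ pa).
    exact: word_cong_e_absorbed.
  by elim: p pn {pq} => [//|[] p IHp] //= /IHp ->.
- by left; rewrite -uv.
- by left; rewrite uv.
Qed.

Lemma e_fixed u n : u ≈ nseq n.+1 gen_e ++ u -> gen_e :: u ≈ u.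
Proof.
move=> /e_fixed_or_count_e[//|].
have -> : count_e_before_bx (nseq n.+1 gen_e ++ u) =
    (n.+1 + count_e_before_bx u)%N.
  by elim: n => //= n ->.
by lia.
Qed.

Lemma e_fixed_nseq u n : gen_e :: u ≈ u -> nseq n gen_e ++ u ≈ u.
Proof. by move=> eu; elim: n => [|n IHn] /=; [apply: WC_refl | rewrite IHn]. Qed.

(** * Antisymmetry of divisibility *)

Lemma word_cong_antisym u v p q r s :
  u ≈ p ++ v ++ q -> v ≈ r ++ u ++ s -> u ≈ v.
Proof.
move=> uv vu.
have upr : u ≈ (p ++ r) ++ u ++ (s ++ q).
  by rewrite {1}uv {1}vu -!catA.
have [epr sq] := stabilizer_letters upr.
have [pe re] : p = nseq (size p) gen_e /\ r = nseq (size r) gen_e.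
  have : all (pred1 gen_e) (p ++ r)
    by rewrite epr; apply/all_pred1P; rewrite size_nseq.
  by rewrite all_cat => /andP[/all_pred1P + /all_pred1P].
have [s0 q0] : s = [::] /\ q = [::] by case: (s) (q) sq => [|? ?] [].
(* If [p] is empty, [uv] is already the claim; otherwise [p] followed by [r] has [(n + size r).+1]
   letters e, a positive power that fixes [u]. *)
move: uv vu; rewrite s0 q0 !cats0 pe re; case: (size p) => [//|n] uv vu.
have eu : gen_e :: u ≈ u.
  apply: (@e_fixed _ (n + size r)); rewrite {1}uv {1}vu.
  by rewrite catA -nseqD.
by rewrite vu e_fixed_nseq.
Qed.

End Lemma5.

Theorem lemma5 :
  let a := letter gen_a in
  let b := letter gen_b in
  let c := letter gen_c in
  let e := letter gen_e in
  let x := letter gen_x in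
  J_trivial
    (presented [:: (a * x * b, a * c * x);
                   (a * c, c * a);
                   (x * c * a, x * e);
                   (e * a, a * e);
                   (a * e * x, a * x);
                   (x * e * x * b, b * x * e * x)]).
Proof.
move=> a b c e x s t st.
have [p [q spq]] := J_related_word st.
have [p' [q' tpq]] := J_related_word (esym st : J_related t s).
exact: word_repr_inj (word_cong_antisym spq tpq).
Qed.
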